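(* For a space $X$ the following conditions are equivalent: (1) $X$ is $\mathrm{I}$-favorable; (2) every embedding of $X$ in another space $Y$ is $\pi$-regular (that is, whenever $X$ is a subspace of a space $Y$, $X$ is $\pi$-regularly embedded in $Y$); (3) $X$ is skeletally generated.
   Context: All topological spaces are Tychonoff and non-empty, and all single-valued maps are continuous. $\mathcal{T}_X$ denotes the topology of $X$. $\mathrm{I}$-favorable: $X$ is $\mathrm{I}$-favorable if player I has a winning strategy in the open-open game, i.e. there is a function $\sigma$ assigning to every finite (possibly empty) sequence of non-empty open subsets of $X$ a non-empty open subset of $X$, such that for every sequence $(U_k)_{k\ge 0}$ of non-empty open subsets of $X$ with $U_0\subset\sigma(\varnothing)$ and $U_{k+1}\subset\sigma(U_0,\dots,U_k)$ for all $k\ge 0$, the union $\bigcup_{k\ge 0}U_k$ is dense in $X$. $\pi$-regularly embedded: a subspace $X\subset Y$ is $\pi$-regularly embedded in $Y$ if there is a function $\mathrm{e}:\mathcal{T}_X\to\mathcal{T}_Y$ such that for all $U,V\in\mathcal{T}_X$: (i) $\mathrm{e}(U)\cap \mathrm{e}(V)=\varnothing$ whenever $U\cap V=\varnothing$; (ii) $\mathrm{e}(U)\cap X$ is a dense subset of $U$. Skeletal map: a map $f:X\to Y$ is skeletal if $\mathrm{Int}\,\overline{f(U)}\neq\varnothing$ for every non-empty open $U\subset X$. Skeletally generated: $X$ is skeletally generated if there is an inverse system $S=\{X_\alpha,p^\beta_\alpha,A\}$ ($A$ a directed partially ordered set, $p^\beta_\alpha:X_\beta\to X_\alpha$ for $\alpha\le\beta$)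 of second countable spaces $X_\alpha$ with skeletal surjective bonding maps $p^\beta_\alpha$ such that: (a) $A$ is $\sigma$-complete, i.e. every countable chain in $A$ has a supremum in $A$; (b) for every countable chain $\{\alpha_n\}_{n\ge1}\subset A$ with $\beta=\sup\{\alpha_n\}_{n\ge 1}$, the space $X_\beta$ is (via the maps $p^\beta_{\alpha_n}$) a dense subspace of $\varprojlim\{X_{\alpha_n},p^{\alpha_{n+1}}_{\alpha_n}\}$; (c) $X$ is embedded in $\varprojlim S$ and $p_\alpha(X)=X_\alpha$ for each $\alpha\in A$, where $p_\alpha:\varprojlim S\to X_\alpha$ is the $\alpha$-th limit projection. *)

(* Defs.v *)
From HB Require Import structures.
From mathcomp Require Import all_boot all_order all_algebra.
From mathcomp Require Import all_classical all_reals all_analysis.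

Set Implicit Arguments.
Unset Strict Implicit.
Unset Printing Implicit Defensive.

Import Order.TTheory.

Local Open Scope classical_set_scope.
Local Open Scope order_scope.

(* The standing assumption on spaces: non-empty and Tychonoff (T3.5); see
   [uniform_separatorP] for [completely_regular_space] in terms of continuous
   functions into [0, 1]. *)
Definition tychonoff_space (X : topologicalType) :=
  [/\ [set: X] !=set0, hausdorff_space X & completely_regular_space X].

Definition nonempty_open (X : topologicalType) (U : set X) :=
  open U /\ U !=set0.

Definition dense_subset (X : topologicalType) (D U : set X) :=
  D `<=` U /\ U `<=` closure D.

(* Homeomorphism onto the image. *)
Definition embedding (X Y : topologicalType) (f : X -> Y) :=
  [/\ injective f, continuous f &
      forall U, open U -> exists2 V, open V & f @` U = V `&` range f].

(* The strategy is a total function on lists of sets, and only its values on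
   lists of non-empty open sets matter. Since [mkseq U k] is the list
   U_0, ..., U_(k-1), the case k = 0 below reads U_0 `<=` sigma [::]. *)
Definition I_favorable (X : topologicalType) :=
  exists sigma : seq (set X) -> set X,
    (forall s, (forall U, U \in s -> nonempty_open U) ->
       nonempty_open (sigma s)) /\
    (forall U : nat -> set X,
       (forall k, nonempty_open (U k)) ->
       (forall k, U k `<=` sigma (mkseq U k)) ->
       dense (\bigcup_k U k)).

(* X is identified with the subspace [range i] of Y, so that the trace on X of
   a subset of Y is its preimage under i. Only the values of e on open sets
   matter. *)
Definition pi_regular (X Y : topologicalType) (i : X -> Y) :=
  exists e : set X -> set Y,
    [/\ (forall U, open U -> open (e U)),
        (forall U V, open U -> open V ->
           U `&` V = set0 -> e U `&` e V = set0) &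
        (forall U, open U -> dense_subset (i @^-1` e U) U)].

Definition skeletal (X Y : topologicalType) (f : X -> Y) :=
  forall U, nonempty_open U -> (closure (f @` U))° !=set0.

(* [bond ab] is the map p^b_a : X_b -> X_a. *)
Record inverse_system (d : Order.disp_t) (A : porderType d) := InverseSystem {
  space :> A -> topologicalType;
  bond : forall a b, a <= b -> space b -> space a;
  bond_id : forall a (aa : a <= a) x, bond aa x = x;
  bond_comp : forall a b c (ab : a <= b) (bc : b <= c) (ac : a <= c) x,
    bond ab (bond bc x) = bond ac x;
  bond_continuous : forall a b (ab : a <= b), continuous (bond ab)
}.

Arguments bond {d A} S {a b} ab x : rename.

Definition inverse_limit (d : Order.disp_t) (A : porderType d)
    (S : inverse_system A) : set (prod_topology (fun a => S a)) :=
  [set x | forall a b (ab : a <= b), bond S ab (x b) = x a].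

Arguments inverse_limit {d A} S x.

Definition sequential_limit (d : Order.disp_t) (A : porderType d)
    (S : inverse_system A) (alpha : nat -> A)
    (alphaS : forall n, alpha n <= alpha n.+1) :
    set (prod_topology (fun n => S (alpha n))) :=
  [set x | forall n, bond S (alphaS n) (x n.+1) = x n].

Arguments sequential_limit {d A} S {alpha} alphaS x.

Definition directed (d : Order.disp_t) (A : porderType d) :=
  [set: A] !=set0 /\ forall a b : A, exists c, a <= c /\ b <= c.

Definition sigma_complete (d : Order.disp_t) (A : porderType d) :=
  forall C : set A, C !=set0 -> countable C ->
    total_on C (fun a b => a <= b) -> supremums C !=set0.

(* A subspace of a subset L of the product is rendered as an embedding into the
   whole product whose range is contained in L. *)
Definition skeletally_generated (X : topologicalType) :=
  exists (d : Order.disp_t) (A : porderType d) (S : inverse_system A),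
    [/\ directed A /\ sigma_complete A,
        (forall a, tychonoff_space (S a) /\ @second_countable (S a)),
        (forall a b (ab : a <= b),
           skeletal (bond S ab) /\ range (bond S ab) = setT),
        (forall (alpha : nat -> A) (alphaS : forall n, alpha n <= alpha n.+1)
           (beta : A) (alpha_beta : forall n, alpha n <= beta),
           supremums (range alpha) beta ->
           let q : S beta -> prod_topology (fun n => S (alpha n)) :=
             fun x n => bond S (alpha_beta n) x in
           embedding q /\
           dense_subset (range q) (sequential_limit S alphaS)) &
        (exists i : X -> prod_topology (fun a => S a),
           [/\ embedding i, range i `<=` inverse_limit S &
               forall a, range (fun x => i x a) = setT])].

(* Main.v *)
Require Import Defs.
From HB Require Import structures.
From mathcomp Require Import all_boot all_order all_algebra.
From mathcomp Require Import finmap wochoice lra.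
From mathcomp Require Import all_classical all_reals all_analysis.
From mathcomp Require Import Rstruct.
From Stdlib Require Rdefinitions.

Set Implicit Arguments.
Unset Strict Implicit.
Unset Printing Implicit Defensive.

Import Order.TTheory GRing.Theory Num.Theory.
Import numFieldNormedType.Exports.

Local Open Scope classical_set_scope.

(** Fix a family f of continuous real functions on X, indexed by K, whose
    rational cylinders form a base of X. Call a set B of coordinates skeletal
    if the map from X onto its image in the product of the lines indexed by B
    is skeletal. All three conditions are compared with a fourth one: there is
    an operation phi, sending finite lists of (codes of) cylinders to
    cylinders, such that the sets of coordinates closed under phi are skeletal.

    - A winning strategy yields phi: pick a cylinder inside the move of the
      strategy. If B is closed under phi and U is an open set on which
      skeletality of B fails, then player II can always answer with a cylinder
      over B that misses U, and the strategy loses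
      ([I_favorable_skeletal_on]).
    - An extension operator e for the diagonal embedding of X in the cube of
      all coordinates yields phi: pick a cylinder inside the part of e (cyl c)
      that lies over c. If e (W) and e (cyl c) are disjoint, then so are their
      projections to the coordinates in B, because a point of the cube may be
      composed from the B-coordinates of one point and the other coordinates
      of another ([pi_regular_skeletal_on]).
    - The countable sets closed under phi form a sigma-complete directed set,
      and the images of X under them form the inverse system of a skeletally
      generated space ([skeletal_skeletally_generated]).
    - In such a system player I climbs along a chain of indices: each move of
      player II contains the preimage of an open set of some later space, and
      player I visits the bases of all spaces of the chain. At the supremum of
      the chain the moves of player II have a dense trace, and skeletality of
      the projection makes their union dense in X
      ([inverse_system_I_favorable]).

    There remains the passage from phi to extension operators in an arbitrary
    space Y containing X ([skeletal_pi_regular]), where the f k are restrictions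
    of functions on Y. For a countable B the coordinates define a
    pseudometric, and the points closer to U than to its complement give an
    operator on the sets that are open over B ([countable_extendable]). Larger
    sets are exhausted by well-ordered increasing unions of closed sets B x,
    each of which has an operator e x. These operators need not agree; on B x
    the operator is corrected by intersecting its value at U with the value,
    for the earlier sets, of the interior of the closure of U, and by adding
    the values that the earlier sets already prescribe. Skeletality of
    the union of the earlier sets is what keeps the corrected values dense in
    U ([union_extendable]). To cover all of K one well-orders K and proves, for
    initial segments D, that the closure of C together with D has an operator
    for all countable C at once: it is the union over x in D of the closures
    of C, x and the predecessors of x, and C with x added is countable again,
    so no cardinal arithmetic is needed ([extendable_setT]). *)

(** * Directed families, countable sets and well-orders *)

(** All uses of finiteness below have this form: finitely many coordinates
    restricted by a basic open set of a product, finitely many coordinates in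
    a code, finitely many codes in a list. *)
Lemma directed_finite (I : Type) (T : eqType) (D : set I) (P : I -> set T) :
  D !=set0 ->
  (forall i j, D i -> D j ->
     exists2 k, D k & P i `<=` P k /\ P j `<=` P k) ->
  forall s : seq T, (forall t, t \in s -> exists2 i, D i & P i t) ->
  exists2 i, D i & forall t, t \in s -> P i t.
Proof.
move=> [i0 Di0] dirD; elim=> [|t s IH] sP; first by exists i0.
have [i Di Pi] := sP t (mem_head _ _).
have [|j Dj Pj] := IH; first by move=> u us; apply: sP; rewrite inE us orbT.
have [k Dk [ik jk]] := dirD i j Di Dj.
by exists k => // u; rewrite inE => /orP[/eqP->|/Pj]; [exact: ik|exact: jk].
Qed.

Lemma countable_setU (T : Type) (A B : set T) :
  countable A -> countable B -> countable (A `|` B).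
Proof.
move=> cA cB; rewrite -bigcup2E; apply: bigcup_countable => //.
by move=> [|[|n]] _ //=; exact: countable0.
Qed.

Lemma countable_enum (T : Type) (B : set T) : countable B -> B !=set0 ->
  exists h : nat -> T, (forall n, B (h n)) /\ (forall x, B x -> exists n, h n = x).
Proof.
move=> /countable_injP[g gi] [x0 Bx0].
have hP n : exists x, B x /\ ((exists2 y, B y & g y = n) -> g x = n).
  have [[y By gy]|nn] := pselect (exists2 y, B y & g y = n); first by exists y.
  by exists x0.
have [h {}hP] := choice hP; exists h; split=> [n|x Bx]; first by have [] := hP n.
exists (g x); have [Bh /(_ (ex_intro2 _ _ x Bx erefl))] := hP (g x).
by apply: gi => //; rewrite inE.
Qed.

Lemma strict_well_order (K : eqType) : exists lt : K -> K -> Prop,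
  [/\ well_founded lt, (forall x y z, lt x y -> lt y z -> lt x z) &
      forall x y, [\/ lt x y, x = y | lt y x]].
Proof.
have [r wo] := well_ordering_principle K.
have wo' : wo_chain r predT by move=> A _; exact: wo.
have rtot x y : r x y || r y x := wo_chainW wo' isT isT.
have ranti x y : r x y && r y x -> x = y.
  exact: (wo_chain_antisymmetric wo').
exists (fun x y => ~~ r y x); split.
- move=> z; apply: contrapT => nz.
  have [|m [[mA minm] _]] := wo [pred x | `[< ~ Acc (fun x y => ~~ r y x) x >]].
    by exists z; apply/asboolP.
  have /asboolP nAm : `[< ~ Acc (fun x y => ~~ r y x) m >] := mA.
  apply: nAm; apply: Acc_intro => y ym.
  apply: contrapT => ny; move: ym; rewrite (minm y) //.
  exact/asboolP.
- move=> x y z yx zy; apply/negP => zx.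
  have [|m [[mA minm] _]] := wo [pred u | u \in [:: x; y; z]].
    by exists x; rewrite !inE eqxx.
  have mx : r m x by apply: minm; rewrite !inE eqxx.
  have my : r m y by apply: minm; rewrite !inE eqxx orbT.
  have mz : r m z by apply: minm; rewrite !inE eqxx !orbT.
  move: mA; rewrite !inE => /or3P[] /eqP mE; subst m.
  + by move: zy; rewrite -(ranti x z) ?mz ?zx // my.
  + by rewrite mx in yx.
  + by rewrite my in zy.
- move=> x y; have [yx|nyx] := boolP (r y x); last by apply: Or31.
  have [xy|nxy] := boolP (r x y); last by apply: Or33.
  by apply: Or32; apply: ranti; rewrite xy yx.
Qed.

(** * Products and embeddings *)

(** The restrictions are listed as subsets M of the whole product, rather than
    as pairs of an index and a subset of its factor, so that they all have the
    same type. *)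
Lemma prod_topology_box (I : eqType) (T : I -> topologicalType)
    (x : prod_topology T) (U : set (prod_topology T)) : nbhs x U ->
  exists s : seq (set (prod_topology T)),
    (forall M, M \in s -> exists j (V : set (T j)),
       [/\ open V, V (x j) & M = [set z | V (z j)]]) /\
    (forall z : prod_topology T, (forall M, M \in s -> M z) -> U z).
Proof.
move=> [_ [[Q Qfin <-] [V QV Vx]] VU].
have [L Lsub LV] := Qfin _ QV.
exists (enum_fset L); split=> [M ML|z zL].
  have /set_mem[j _ [W oW WM]] := Lsub _ ML.
  exists j, W; split=> //.
  have Mx : M x by move: Vx; rewrite -LV; apply.
  by move: Mx; rewrite -WM.
have Vz : V z by rewrite -LV => M ML; exact: zL.
by apply: VU; exists V.
Qed.

Lemma prod_continuous (Z : topologicalType) (I : eqType)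
    (T : I -> topologicalType) (h : Z -> prod_topology T) :
  (forall j, continuous (fun z => h z j)) -> continuous h.
Proof.
move=> hc z U /prod_topology_box[s [sP sU]].
rewrite nbhs_simpl /=.
suff : nbhs z [set z' | forall M, M \in s -> M (h z')].
  by apply: filterS => z' ?; exact: sU.
elim: s sP {sU} => [|M s IH] sP; first exact: filterE.
have /IH{}IH : forall M, M \in s -> exists j (V : set (T j)),
    [/\ open V, V (h z j) & M = [set z | V (z j)]].
  by move=> N Ns; apply: sP; rewrite inE Ns orbT.
have [j [V [oV Vz ME]]] := sP M (mem_head _ _).
have : nbhs z [set z' | V (h z' j)].
  by apply: hc; exact: open_nbhs_nbhs.
move: IH; apply: filterS2 => z' sz' Vz' N; rewrite inE => /orP[/eqP->|].
  by rewrite ME.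
exact: sz'.
Qed.

Lemma prod_coord_continuous (I : eqType) (T : I -> topologicalType) (j : I) :
  continuous (fun z : prod_topology T => z j).
Proof. exact: proj_continuous. Qed.

Lemma local_embedding (Z W : topologicalType) (h : Z -> W) :
  injective h -> continuous h ->
  (forall U z, open U -> U z ->
     exists V, [/\ open V, V (h z) & forall z', V (h z') -> U z']) ->
  embedding h.
Proof.
move=> hinj hc hloc; split=> // U oU.
pose small V := open V /\ forall z', V (h z') -> U z'.
exists (\bigcup_(V in small) V); first by apply: bigcup_open => V [].
apply/seteqP; split=> [_ [z Uz <-]|w [[V [_ VU] Vw] [z _ zw]]].
  have [V [oV Vz VU]] := hloc U z oU Uz.
  by split; [exists V|exists z].
by exists z => //; apply: VU; rewrite zw.
Qed.

(** * From inverse systems to the open-open game *)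

Section DirectedEmbedding.
Local Open Scope order_scope.

(** A basic neighbourhood in the product restricts finitely many coordinates,
    and all of these factor through a single later one. *)
Lemma directed_embedding_base (d : Order.disp_t) (J : porderType d)
    (T : J -> topologicalType) (Z : topologicalType) (i : Z -> prod_topology T) :
  embedding i -> (forall a b : J, exists c, a <= c /\ b <= c) ->
  (forall a b, a <= b ->
     exists2 h : T b -> T a, continuous h & forall z, h (i z b) = i z a) ->
  forall (a : J) (U : set Z) z, open U -> U z ->
  exists b, a <= b /\ exists V : set (T b),
    [/\ open V, V (i z b) & forall z', V (i z' b) -> U z'].
Proof.
move=> [inj_i _ open_i] dir fac a U z oU Uz.
have [Q oQ iU] := open_i U oU.
have Qz : Q (i z).
  have : (i @` U) (i z) by exists z.
  by rewrite iU => -[].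
have QU z' : Q (i z') -> U z'.
  move=> Qz'; have : (Q `&` range i) (i z') by split=> //; exists z'.
  by rewrite -iU => -[z'' Uz'' /inj_i <-].
have /prod_topology_box[s [sP sQ]] : nbhs (i z) Q by exact: open_nbhs_nbhs.
pose nbh := {b : J & set (T b)}.
pose trace (t : nbh) : set Z :=
  [set z' | (projT2 t : set (T (projT1 t))) (i z' (projT1 t))].
pose D : set nbh := [set t | [/\ a <= projT1 t, open (projT2 t) & trace t z]].
pose P (t : nbh) : set (set (prod_topology T)) :=
  [set M | forall z', trace t z' -> M (i z')].
have pull b c (V : set (T b)) : open V -> V (i z b) -> b <= c ->
    exists W : set (T c), [/\ open W, W (i z c) &
      forall z', W (i z' c) -> V (i z' b)].
  move=> oV Vz bc; have [h hc hi] := fac b c bc.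
  exists (h @^-1` V); split=> [||z' /=]; last by rewrite hi.
    by apply: open_comp => // x _; exact: hc.
  by rewrite /= hi.
have [|[b V] [b' V'] [/= ab oV Vz] [/= ab' oV' Vz']|M /sP|[b V] [/= ab oV Vz] Vs] :=
  @directed_finite _ _ D P _ _ s.
- by exists (existT _ a setT); split=> //; exact: openT.
- have [c [bc bc']] := dir b b'.
  have [W [oW Wz WV]] := pull b c V oV Vz bc.
  have [W' [oW' Wz' WV']] := pull b' c V' oV' Vz' bc'.
  exists (existT _ c (W `&` W')).
    by split=> //=; [exact: le_trans ab bc|exact: openI].
  split=> M MV z' /= [Wz'' Wz''']; apply: MV; first exact: WV.
  exact: WV'.
- move=> [b [V [oV Vz ->]]].
  have [c [ac bc]] := dir a b; have [W [oW Wz WV]] := pull b c V oV Vz bc.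
  by exists (existT _ c W).
- exists b; split=> //; exists V; split=> // z' Vz'.
  by apply: QU; apply: sQ => M Ms; exact: Vs.
Qed.

End DirectedEmbedding.

Section Game.
Local Open Scope order_scope.
Variables (X : topologicalType) (d : Order.disp_t) (A : porderType d).
Variables (S : inverse_system A) (i : X -> prod_topology (fun a => S a)).
Hypothesis A_dir : directed A.
Hypothesis A_sigma : sigma_complete A.
Hypothesis S_space : forall a, tychonoff_space (S a) /\ @second_countable (S a).
Hypothesis S_skel : forall a b (ab : a <= b),
  skeletal (bond S ab) /\ range (bond S ab) = setT.
Hypothesis S_cont : forall (alpha : nat -> A)
    (alphaS : forall n, alpha n <= alpha n.+1)
    (beta : A) (alpha_beta : forall n, alpha n <= beta),
  supremums (range alpha) beta ->
  embedding (fun x => (fun n => bond S (alpha_beta n) x)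
    : prod_topology (fun n => S (alpha n))).
Hypothesis i_emb : embedding i.
Hypothesis i_lim : range i `<=` inverse_limit S.
Hypothesis i_onto : forall a, range (fun x => i x a) = setT.

Let i_bond a b (ab : a <= b) x : bond S ab (i x b) = i x a.
Proof. by have := i_lim (imageT i x); exact. Qed.

Let i_surj a (y : S a) : exists x, i x a = y.
Proof.
have : [set: S a] y by [].
by rewrite -(i_onto a) => -[x _ <-]; exists x.
Qed.

Let i_cont a : continuous (fun x => i x a).
Proof.
have [_ ic _] := i_emb => x.
apply: (@continuous_comp _ _ _ i (fun z : prod_topology (fun a => S a) => z a)).
  exact: ic.
exact: prod_coord_continuous.
Qed.

Let base_refine a (U : set X) : nonempty_open U ->
  exists b, a <= b /\ exists V : set (S b),
    nonempty_open V /\ forall x, V (i x b) -> U x.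
Proof.
move=> [oU [x Ux]].
have [||b [ab [V [oV Vx VU]]]] := directed_embedding_base i_emb _ _ a oU Ux.
- exact: A_dir.2.
- move=> b c bc; exists (bond S bc); first exact: bond_continuous.
  by move=> z; exact: i_bond.
by exists b; split=> //; exists V; split=> //; split=> //; exists (i x b).
Qed.

(** Skeletality passes from the bonds to the projections of X, as every
    non-empty open subset of X contains the trace of an open subset of some
    later S b. *)
Let proj_skeletal a : skeletal (fun x => i x a).
Proof.
move=> U /(base_refine a)[b [ab [V [oV VU]]]].
have [/(_ V oV)[y Vy] _] := S_skel ab.
exists y; move: Vy; apply: interiorS; apply: closureS.
move=> _ [v Vv <-]; have [x xv] := i_surj v.
by exists x; [apply: VU; rewrite xv|rewrite -xv i_bond].
Qed.

(** Player I computes from the past moves of player II a chain alpha of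
    indices, where every move contains the preimage of an open set V of the
    next space of the chain, and plays preimages of the basic open sets of all
    spaces S (alpha m). Suppose an open set O misses all moves. The closure of
    its image in the space of the supremum beta contains a basic open set,
    which comes from some S (alpha m); when player I played it, player II
    answered with a set whose V lies, seen in S beta, in that closure but off
    the image of O. *)
Lemma inverse_system_I_favorable : I_favorable X.
Proof.
have [a0 _] := A_dir.1.
have [x0 _] : [set: X] !=set0.
  have [[y _]] := (S_space a0).1; have [x _] := i_surj y; by exists x.
have base_ex a : exists G : nat -> set (S a),
    (forall n, open (G n)) /\
    forall (O : set (S a)) y, open O -> O y -> exists n, G n y /\ G n `<=` O.
  have [B cB [Bo Bb]] := (S_space a).2.
  have B0 : B !=set0.
    have [V [BV _] _] := Bb (i x0 a) setT filterT; by exists V.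
  have [h [hB Bh]] := countable_enum cB B0.
  exists h; split=> [n|O y' oO Oy']; first exact/Bo/hB.
  have [V [BV Vy'] VO] := Bb y' O (open_nbhs_nbhs (conj oO Oy')).
  by have [n hn] := Bh V BV; exists n; rewrite hn.
pose base a := projT1 (cid (base_ex a)).
have baseP a : (forall n, open (base a n)) /\
    forall (O : set (S a)) y, open O -> O y ->
      exists n, base a n y /\ base a n `<=` O := projT2 (cid (base_ex a)).
have /choice[next nextP] : forall aU : A * set X, exists b,
    nonempty_open aU.2 -> aU.1 <= b /\ exists V : set (S b),
      nonempty_open V /\ forall x, V (i x b) -> aU.2 x.
  move=> [a U]; have [oU|] := pselect (nonempty_open U); last by exists a.
  by have [b bP] := base_refine a oU; exists b => _.
pose stage (s : seq (set X)) := foldl (fun a U => next (a, U)) a0 s.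
(* Position k prescribes the n-th basic open set of the m-th space of the
   chain, where 2 ^ m and 3 ^ n are the exact powers dividing k + 1; this
   reaches all pairs (m, n), and only with m <= k, when alpha m is known. *)
pose target (s : seq (set X)) : set X :=
  let a := stage (take (logn 2 (size s).+1) s) in
  [set x | base a (logn 3 (size s).+1) (i x a)].
have target_open s : open (target s).
  rewrite /target; move: (stage _) (logn 3 _) => a n.
  apply: (@open_comp _ _ (fun x => i x a) (base a n)).
    by move=> x _; exact: i_cont.
  exact: (baseP a).1.
exists (fun s => if `[< target s !=set0 >] then target s else setT); split.
  move=> s _; case: asboolP => [//|_].
  by split; [exact: openT|exists x0].
move=> U oU Usigma.
pose alpha n := stage (mkseq U n).
have alphaE n : alpha n.+1 = next (alpha n, U n).
  by rewrite /alpha mkseqS /stage foldl_rcons.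
have alphaS n : alpha n <= alpha n.+1.
  by rewrite alphaE; have [] := nextP (alpha n, U n) (oU n).
have alpha_mono m n : (m <= n)%N -> alpha m <= alpha n.
  move=> /subnK<-; elim: (n - m)%N => [|p IH] //.
  by rewrite addSn (le_trans IH).
have [beta bsup] : supremums (range alpha) !=set0.
  apply: A_sigma.
  - by exists (alpha 0%N); exists 0%N.
  - by apply: (sub_countable (card_image_le _ _)); exact: countableP.
  - move=> _ _ [m _ <-] [n _ <-].
    by have /orP[mn|nm] := leq_total m n; [left|right]; exact: alpha_mono.
have alpha_beta n : alpha n <= beta.
  by have [+ _] := bsup; apply; exists n.
have q_emb := S_cont alphaS alpha_beta bsup.
move=> O O0 oO; apply: contrapT => OU0.
have [y Hy] := proj_skeletal beta (conj oO O0).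
set H := closure _ in Hy.
have [|m n mn|m [_ [G [oG Gy GH]]]] :=
  directed_embedding_base (J := nat) q_emb _ _ 0%N (@open_interior _ H) Hy.
- by move=> m n; exists (maxn m n); rewrite !leEnat leq_maxl leq_maxr.
- have mn' := alpha_mono m n mn.
  exists (bond S mn'); first exact: bond_continuous.
  by move=> z; exact: bond_comp.
have [j [Gjy GjG]] := (baseP (alpha m)).2 G _ oG Gy.
pose k := (2 ^ m * 3 ^ j).-1.
have kE : k.+1 = (2 ^ m * 3 ^ j)%N by rewrite prednK // muln_gt0 !expn_gt0.
have k2 : logn 2 k.+1 = m.
  by rewrite kE lognM ?expn_gt0 // !lognX /= !logn_prime //= muln1 muln0 addn0.
have k3 : logn 3 k.+1 = j.
  by rewrite kE lognM ?expn_gt0 // !lognX /= !logn_prime //= muln1 muln0.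
have mk : (m <= k)%N.
  rewrite -ltnS kE (leq_trans (ltn_expl m (ltnSn 1))) // leq_pmulr //.
  by rewrite expn_gt0.
have targetE : target (mkseq U k) = [set x | base (alpha m) j (i x (alpha m))].
  rewrite /target size_mkseq k2 k3.
  have -> : take m (mkseq U k) = mkseq U m.
    by rewrite /mkseq -map_take take_iota (minn_idPl mk).
  by [].
have := Usigma k; rewrite targetE.
case: asboolP => [_ Uk|[]]; last first.
  have [x xy] := i_surj (bond S (alpha_beta m) y); exists x.
  by rewrite /= xy.
have [_ [V [[oV [v Vv]] VU]]] := nextP (alpha k, U k) (oU k).
rewrite -alphaE in V oV v Vv VU.
pose V' := bond S (alpha_beta k.+1) @^-1` V.
have oV' : open V'.
  by apply: open_comp => // z _; exact: bond_continuous.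
have V'O x : V' (i x beta) -> U k x by rewrite /V' /= i_bond; exact: VU.
have V'H : V' `<=` closure ((fun x => i x beta) @` O).
  move=> z; have [x <-] := i_surj z => /V'O /Uk /= Gx.
  apply: interior_subset; apply: GH.
  by rewrite i_bond; exact: GjG.
have [x xv] := i_surj v.
have V'x : V' (i x beta) by rewrite /V' /= i_bond xv.
have [_ [[x' Ox' <-] /V'O Ux']] := V'H _ V'x V' (open_nbhs_nbhs (conj oV' V'x)).
by apply: OU0; exists x'; split=> //; exists k.
Qed.

End Game.

Local Open Scope ring_scope.

(** * Rational cylinders *)

Section Cylinders.
Context {R : realType} {K : choiceType}.

(** The end points of the intervals are rational in order that a countable set
    of coordinates carries only countably many codes. *)
Definition boxcode := seq (K * (rat * rat)).

Definition keys_in (B : set K) (c : boxcode) := forall t, t \in c -> B t.1.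

Definition cyl (Z : Type) (f : K -> Z -> R) (c : boxcode) : set Z :=
  [set z | forall t, t \in c -> ratr t.2.1 < f t.1 z < ratr t.2.2].

(** The open sets of the initial topology of the coordinates in B. *)
Definition Bopen (Z : Type) (f : K -> Z -> R) (B : set K) (U : set Z) :=
  forall z, U z -> exists c, [/\ keys_in B c, cyl f c z & cyl f c `<=` U].

Definition generating (Z : topologicalType) (f : K -> Z -> R) :=
  (forall k, continuous (f k)) /\
  (forall U : set Z, open U -> Bopen f setT U).

Lemma keys_in_cat B c d : keys_in B c -> keys_in B d -> keys_in B (c ++ d).
Proof. by move=> oc od t; rewrite mem_cat => /orP[/oc|/od]. Qed.

Lemma keys_in_sub (B B' : set K) c : B `<=` B' -> keys_in B c -> keys_in B' c.
Proof. by move=> BB' oc t /oc /BB'. Qed.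

Lemma cyl_cat Z (f : K -> Z -> R) c d : cyl f (c ++ d) = cyl f c `&` cyl f d.
Proof.
apply/seteqP; split => z.
  by move=> cd; split=> t tc; apply: cd; rewrite mem_cat tc ?orbT.
by case=> cz dz t; rewrite mem_cat => /orP[/cz|/dz].
Qed.

Lemma cyl_nil Z (f : K -> Z -> R) : cyl f [::] = setT.
Proof. by apply/seteqP; split. Qed.

Lemma cyl_open (Z : topologicalType) (f : K -> Z -> R) c :
  (forall k, continuous (f k)) -> open (cyl f c).
Proof.
move=> cf; elim: c => [|t c IH]; first by rewrite cyl_nil; exact: openT.
have -> : cyl f (t :: c) =
    f t.1 @^-1` [set r | ratr t.2.1 < r < ratr t.2.2] `&` cyl f c.
  apply/seteqP; split => z.
    move=> tc; split; first by apply: tc; exact: mem_head.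
    by move=> u uc; apply: tc; rewrite inE uc orbT.
  by case=> tz cz u; rewrite inE => /orP[/eqP->|/cz].
apply: openI => //; apply: open_comp; first by move=> z _; exact: cf.
have -> : [set r : R | ratr t.2.1 < r < ratr t.2.2] =
    `]ratr t.2.1, ratr t.2.2[%classic.
  by apply/seteqP; split => r /=; rewrite in_itv.
exact: interval_open.
Qed.

Lemma Bopen_sub Z (f : K -> Z -> R) (B B' : set K) U :
  B `<=` B' -> Bopen f B U -> Bopen f B' U.
Proof.
move=> BB' oU z /oU[c [oc cz cU]]; exists c; split=> //; exact: keys_in_sub oc.
Qed.

Lemma Bopen_open (Z : topologicalType) (f : K -> Z -> R) B U :
  (forall k, continuous (f k)) -> Bopen f B U -> open U.
Proof.
move=> cf oU; rewrite openE => z /oU[c [_ cz cU]]; rewrite /interior nbhsE.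
by exists (cyl f c) => //; split=> //; exact: cyl_open.
Qed.

(** The interior in the initial topology of the coordinates in B. *)
Definition Bint Z (f : K -> Z -> R) (B : set K) (U : set Z) : set Z :=
  [set z | exists c, [/\ keys_in B c, cyl f c z & cyl f c `<=` U]].

Lemma Bint_sub Z (f : K -> Z -> R) B U : Bint f B U `<=` U.
Proof. by move=> z [c [_ cz cU]]; exact: cU. Qed.

Lemma Bint_open Z (f : K -> Z -> R) B U : Bopen f B (Bint f B U).
Proof.
by move=> z [c [oc cz cU]]; exists c; split=> // w cw; exists c.
Qed.

Lemma Bint_Bint Z (f : K -> Z -> R) (B B' : set K) U :
  B `<=` B' -> Bint f B (Bint f B' U) = Bint f B U.
Proof.
move=> BB'; apply/seteqP; split=> z [c [oc cz cU]]; exists c; split=> //.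
  by move=> w /cU; exact: Bint_sub.
move=> w cw; exists c; split=> //; exact: keys_in_sub oc.
Qed.

Lemma rat_window (r e : R) : 0 < e -> exists q : rat * rat,
  (ratr q.1 < r < ratr q.2) /\
  (forall r', ratr q.1 < r' < ratr q.2 -> `|r - r'| < e).
Proof.
move=> e0.
have re : r - e < r by rewrite ltrBlDr ltrDl.
have er : r < r + e by rewrite ltrDl.
have [a] := rat_in_itvoo re; rewrite in_itv /= => /andP[ra ar].
have [b] := rat_in_itvoo er; rewrite in_itv /= => /andP[rb br].
exists (a, b) => /=; split; first by rewrite ar rb.
move=> r' /andP[ar' rb']; rewrite distrC ltr_distl; apply/andP; split.
  exact: lt_trans ra ar'.
exact: lt_trans rb' br.
Qed.

Lemma generating_injective (Z : topologicalType) (f : K -> Z -> R) z z' :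
  hausdorff_space Z -> generating f -> (forall k, f k z = f k z') -> z = z'.
Proof.
move=> Z_hausdorff [_ gf] zz'; apply: Z_hausdorff => U V Uz Vz'.
have [c [_ cz cU]] := gf (U°) (open_interior U) z Uz.
exists z'; split; last exact: nbhs_singleton.
by apply: interior_subset; apply: cU => t tc; rewrite -zz'; exact: cz.
Qed.

End Cylinders.

Arguments boxcode : clear implicits.

Lemma cube_hausdorff (R : realType) (K : eqType) :
  hausdorff_space (prod_topology (fun _ : K => R)).
Proof. by apply: hausdorff_product => _; exact: norm_hausdorff. Qed.

Lemma cube_generating (R : realType) (K : choiceType) :
  generating (fun (k : K) (z : prod_topology (fun _ : K => R)) => z k).
Proof.
split=> [k|U oU x Ux]; first exact: (@prod_coord_continuous _ (fun _ : K => R) k).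
have /prod_topology_box[s [sP sU]] : nbhs x U by exact: open_nbhs_nbhs.
set g := fun k (z : prod_topology (fun _ : K => R)) => z k.
have [||M /sP[k [V [oV Vx ->]]]|c cx cs] :=
  @directed_finite _ _ [set c | cyl g c x] (fun c => [set M | cyl g c `<=` M]) _ _ s.
- by exists [::]; rewrite /= cyl_nil.
- move=> c d cx dx; exists (c ++ d); rewrite /= cyl_cat //.
  by split=> M cM z [cz dz]; [exact: cM cz|exact: cM dz].
- have : nbhs (x k) V by exact: open_nbhs_nbhs.
  rewrite -nbhs_ballE => -[e /= e0 eV].
  have [q [xq qe]] := rat_window (x k) e0.
  exists [:: (k, q)] => [t|z cz] /=; first by rewrite inE => /eqP->.
  by apply: eV; apply: qe; exact: (cz (k, q) (mem_head _ _)).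
- by exists c; split=> // z cz; apply: sU => M Ms; exact: cs.
Qed.

Lemma cube_tychonoff (R : realType) (K : eqType) :
  tychonoff_space (prod_topology (fun _ : K => R)).
Proof.
split; first by exists (fun _ => 0).
  exact: cube_hausdorff.
exact: (@uniform_completely_regular R (prod_topology (fun _ : K => R))).
Qed.

(** * Closing sets of indices under a finitary operation *)

Section Hull.
Context {K : choiceType}.
Implicit Types (B D : set K) (c : boxcode K).

Definition all_keys_in (B : set K) : set (seq (boxcode K)) :=
  [set s | forall c, c \in s -> keys_in B c].

(** The argument of phi is a list because the moves of a strategy depend on all
    the previous moves. *)
Definition closed_under (phi : seq (boxcode K) -> boxcode K) : set (set K) :=
  [set B | forall s, all_keys_in B s -> keys_in B (phi s)].

Definition hull phi (D : set K) : set K := smallest (closed_under phi) D.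

Lemma sub_hull phi D : D `<=` hull phi D.
Proof. exact: sub_smallest. Qed.

Lemma hull_closed phi D : closed_under phi (hull phi D).
Proof.
move=> s sD t ts B [cB DB]; apply: (cB s) => // c cs u uc.
exact: sD cs u uc B (conj cB DB).
Qed.

Lemma hull_min phi D B : closed_under phi B -> D `<=` B -> hull phi D `<=` B.
Proof. by move=> cB DB k; apply. Qed.

Lemma hull_sub phi D D' : D `<=` D' -> hull phi D `<=` hull phi D'.
Proof.
move=> DD'; apply: hull_min; first exact: hull_closed.
by move=> k /DD'; exact: sub_hull.
Qed.

Section Directed.
Variables (I : Type) (D : set I) (B : I -> set K).
Hypothesis D0 : D !=set0.
Hypothesis dirB : forall i j, D i -> D j ->
  exists2 k, D k & B i `<=` B k /\ B j `<=` B k.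

Lemma keys_in_bigcup c : keys_in (\bigcup_(i in D) B i) c ->
  exists2 i, D i & keys_in (B i) c.
Proof.
move=> oc; apply: (directed_finite (P := fun i => [set t | B i t.1])) => //.
move=> j l Dj Dl; have [k Dk [jk lk]] := dirB Dj Dl.
by exists k => //; split=> t; [exact: jk|exact: lk].
Qed.

Lemma all_keys_in_bigcup s : all_keys_in (\bigcup_(i in D) B i) s ->
  exists2 i, D i & all_keys_in (B i) s.
Proof.
move=> os; apply: (directed_finite (P := fun i => [set c | keys_in (B i) c])) => //.
  move=> j l Dj Dl; have [k Dk [jk lk]] := dirB Dj Dl.
  by exists k => //; split=> c; exact: keys_in_sub.
by move=> c /os/keys_in_bigcup.
Qed.

Lemma closed_under_bigcup phi : (forall i, D i -> closed_under phi (B i)) ->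
  closed_under phi (\bigcup_(i in D) B i).
Proof.
move=> cB s /all_keys_in_bigcup[i Di os]; apply: (@keys_in_sub _ (B i)).
  by move=> k; exists i.
exact: cB.
Qed.

End Directed.

Lemma countable_all_keys_in B : countable B -> countable (all_keys_in B).
Proof.
move=> cB; have [->|/set0P[k0 Bk0]] := eqVneq B set0.
  apply: (@sub_countable _ _ _ (range (fun n => nseq n ([::] : boxcode K)))).
    apply: subset_card_le => s os; exists (size s) => //.
    elim: s os => [|c s IH] os //=; rewrite IH.
      by case: c os => // t c /(_ _ (mem_head _ _) t (mem_head _ _)).
    by move=> d ds; apply: os; rewrite inE ds orbT.
  by apply: (sub_countable (card_image_le _ _)); exact: countableP.
have [h [_ hB]] := countable_enum cB (ex_intro _ k0 Bk0).
pose H (s : seq (seq (nat * (rat * rat)))) : seq (boxcode K) :=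
  map (map (fun t => (h t.1, t.2))) s.
apply: (@sub_countable _ _ _ (range H)); last first.
  by apply: (sub_countable (card_image_le _ _)); exact: countableP.
apply: subset_card_le => s; elim: s => [|c s IH] os; first by exists [::].
have [|s' _ <-] := IH; first by move=> d ds; apply: os; rewrite inE ds orbT.
suff [c' <-] : exists c' : seq (nat * (rat * rat)),
    map (fun t => (h t.1, t.2)) c' = c :> boxcode K.
  by exists (c' :: s').
have {os} : keys_in B c by apply: os; exact: mem_head.
elim: c => [|t c IHc] oc; first by exists [::].
have [|c' <-] := IHc; first by move=> u uc; apply: oc; rewrite inE uc orbT.
have [n hn] := hB _ (oc _ (mem_head _ _)).
by exists ((n, t.2) :: c') => /=; rewrite hn -surjective_pairing.
Qed.

(** The hull is reached after countably many rounds of adding the values of phi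
    on the lists at hand, of which there are countably many. *)
Lemma countable_hull phi D : countable D -> countable (hull phi D).
Proof.
move=> cD.
pose step (B : set K) :=
  B `|` \bigcup_(s in all_keys_in B) [set k | k \in map fst (phi s)].
pose E n := iter n step D.
have cE n : countable (E n).
  elim: n => //= n IH; apply: countable_setU => //.
  apply: bigcup_countable; first exact: countable_all_keys_in.
  by move=> s _; apply: finite_set_countable; exact: finite_seq.
have Em m n : (m <= n)%N -> E m `<=` E n.
  move=> /subnK<-; elim: (n - m)%N => [|p IH] //.
  by apply: subset_trans IH _ => k Ek; left.
apply: (@sub_countable _ _ _ (\bigcup_n E n)); last first.
  by apply: bigcup_countable.
apply: subset_card_le; apply: hull_min; last by move=> k Dk; exists 0%N.
move=> s /all_keys_in_bigcup[||n _ os].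
- by exists 0%N.
- move=> i j _ _; exists (maxn i j) => //.
  by split; apply: Em; rewrite ?leq_maxl ?leq_maxr.
move=> t ts; exists n.+1 => //; right; exists s => //=.
by apply/mapP; exists t.
Qed.

End Hull.

(** * Skeletal sets of coordinates *)

Section SkeletalCoordinates.
Context {R : realType} {K : choiceType} (X : topologicalType).
Variable f : K -> X -> R.

(** Skeletality of the map from X onto its image under the coordinates in B,
    expressed within X: the image of cyl f c is an open subset of the closure
    of the image of U. *)
Definition skeletal_on (B : set K) := forall U : set X, nonempty_open U ->
  exists c, [/\ keys_in B c, cyl f c !=set0 &
    forall d, keys_in B d -> cyl f (c ++ d) !=set0 ->
      cyl f (c ++ d) `&` U !=set0].

Lemma not_skeletal_on B : ~ skeletal_on B ->
  exists2 U : set X, nonempty_open U &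
    forall c, keys_in B c -> cyl f c !=set0 ->
    exists d, [/\ keys_in B d, cyl f (c ++ d) !=set0 &
      cyl f (c ++ d) `&` U = set0].
Proof.
move=> /existsNP[U /not_implyP[oU nU]]; exists U => // c oc c0.
apply: contrapT => nd; apply: nU; exists c; split=> // d od cd0.
apply: contrapT => /set0P/negP; rewrite negbK => /eqP cdU.
by apply: nd; exists d.
Qed.

(** If W has a nowhere dense image under the coordinates in B, then each
    non-empty cylinder over B contains a smaller one that misses W. As phi
    yields a cylinder over B inside the next move of player I, player II can
    play cylinders over B that miss W throughout. *)
Lemma I_favorable_skeletal_on : generating f -> I_favorable X ->
  exists phi, forall B, closed_under phi B -> skeletal_on B.
Proof.
move=> [cf gf] [sigma [sigma_open sigma_win]].
pose good (s : seq (boxcode K)) c := (forall d, d \in s -> cyl f d !=set0) ->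
  cyl f c !=set0 /\ cyl f c `<=` sigma (map (cyl f) s).
have /choice[phi phiP] : forall s, exists c, good s c.
  move=> s; have [s0|ns0] := pselect (forall d, d \in s -> cyl f d !=set0).
    have [|os [x sx]] := sigma_open (map (cyl f) s).
      by move=> _ /mapP[d ds ->]; split; [exact: cyl_open|exact: s0].
    have [c [_ cx cs]] := gf _ os _ sx.
    by exists c => _; split=> //; exists x.
  by exists [::].
exists phi => B cB; apply: contrapT => /not_skeletal_on[W oW avoid].
have /choice[psi psiP] : forall c, exists c', keys_in B c -> cyl f c !=set0 ->
    [/\ keys_in B c', cyl f c' !=set0, cyl f c' `<=` cyl f c &
        cyl f c' `&` W = set0].
  move=> c; have [oc|] := pselect (keys_in B c); last by exists [::].
  have [c0|] := pselect (cyl f c !=set0); last by exists [::].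
  have [d [od cd0 cdW]] := avoid c oc c0.
  exists (c ++ d) => _ _; split=> //; first exact: keys_in_cat.
  by rewrite cyl_cat; exact: subIsetl.
pose play n : seq (boxcode K) := iter n (fun s => rcons s (psi (phi s))) [::].
have playP n : all_keys_in B (play n) /\
    forall d, d \in play n -> cyl f d !=set0.
  elim: n => [|n [IHB IH0]]; first by split.
  have [phi0 _] := phiP _ IH0.
  have [oc c0 _ _] := psiP _ (cB _ IHB) phi0.
  by split=> d; rewrite mem_rcons inE => /orP[/eqP->//|]; [exact: IHB|exact: IH0].
pose U n := cyl f (psi (phi (play n))).
have UE n : mkseq U n = map (cyl f) (play n).
  by elim: n => //= n IH; rewrite mkseqS IH map_rcons.
have UP n : [/\ U n !=set0, U n `<=` sigma (mkseq U n) & U n `&` W = set0].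
  have [IHB IH0] := playP n; have [phi0 phis] := phiP _ IH0.
  have [_ c0 cphi cW] := psiP _ (cB _ IHB) phi0.
  by split=> //; rewrite UE; exact: subset_trans phis.
have dU : dense (\bigcup_k U k).
  apply: sigma_win => k; last by have [] := UP k.
  by split; [exact: cyl_open|have [] := UP k].
have [oW1 W0] := oW.
have [x [Wx [n _ Ux]]] := dU _ W0 oW1.
have [_ _ UW] := UP n.
by have : (U n `&` W) x by []; rewrite UW.
Qed.

End SkeletalCoordinates.

(** * Extension operators over sets of coordinates *)

Section Extenders.
Context {R : realType} {K : choiceType} (X Y : topologicalType).
Variables (i : X -> Y) (g : K -> Y -> R).
Let f k := g k \o i.

Lemma Bopen_preimage B V : Bopen g B V -> Bopen f B (i @^-1` V).
Proof.
by move=> oV x /oV[c [oc cx cV]]; exists c; split=> // x'; exact: cV.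
Qed.

(** The extension operators of pi-regular embeddings, for the topologies that
    the coordinates in B induce on X and Y; the last clause says that the trace
    of e U is dense in U. *)
Definition extender (B : set K) (e : set X -> set Y) :=
  [/\ forall U, Bopen f B U -> Bopen g B (e U),
      forall U V, Bopen f B U -> Bopen f B V ->
        U `&` V = set0 -> e U `&` e V = set0,
      forall U, Bopen f B U -> i @^-1` e U `<=` U &
      forall U c, Bopen f B U -> keys_in B c -> cyl f c !=set0 ->
        cyl f c `<=` U -> cyl f c `&` i @^-1` e U !=set0].

Definition extendable B := exists e, extender B e.

Section Countable.
Variable h : nat -> K.

(* The entourages of a pseudometric inducing the topology of the coordinates
   h j; consecutive radii halve, so near n contains the square of near n.+1. *)
Let near n (y z : Y) := forall j, (j < n)%N ->
  `|g (h j) y - g (h j) z| < 2^-1 ^+ n.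

Let near_le m n y z : (m <= n)%N -> near n y z -> near m y z.
Proof.
move=> mn yz j jm; apply: lt_le_trans (yz j (leq_trans jm mn)) _.
by apply: ler_wiXn2l => //; rewrite ?invr_le1 ?unitfE ?invr_ge0 ?ler1n.
Qed.

Let near_tri m n x y z : (m <= n)%N ->
  near m.+1 x z -> near n.+1 y z -> near m x y.
Proof.
move=> mn xz yz j jm.
have {}xz := xz j (ltn_trans jm (ltnSn m)).
have {}yz := near_le (m := m.+1) (n := n.+1) mn yz (ltn_trans jm (ltnSn m)).
rewrite exprS in xz yz; move: (2^-1 ^+ m) xz yz => r.
rewrite !ltr_norml => /andP[? ?] /andP[? ?]; apply/andP; split; lra.
Qed.

Let near_Bopen B n y : (forall j, B (h j)) -> Bopen g B (near n y).
Proof.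
move=> Bh z yz.
have /choice[q qP] : forall j, exists q : rat * rat, (j < n)%N ->
    (ratr q.1 < g (h j) z < ratr q.2) /\
    (forall r', ratr q.1 < r' < ratr q.2 ->
       `|g (h j) z - r'| < 2^-1 ^+ n - `|g (h j) y - g (h j) z|).
  move=> j; have [jn|] := ltnP j n; last by exists (0, 0).
  have [|q] := @rat_window R (g (h j) z) (2^-1 ^+ n - `|g (h j) y - g (h j) z|).
    by rewrite subr_gt0; exact: yz.
  by move=> qP; exists q => _; exact: qP.
exists [seq (h j, q j) | j <- iota 0 n]; split.
- by move=> _ /mapP[j _ ->]; exact: Bh.
- by move=> _ /mapP[j + ->]; rewrite mem_iota => /qP[].
move=> w cw j jn; have [_ /(_ (g (h j) w))] := qP j jn.
have jP : (h j, q j) \in [seq (h j, q j) | j <- iota 0 n].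
  by apply/mapP; exists j => //; rewrite mem_iota.
move=> /(_ (cw _ jP)).
have := ler_distD (g (h j) z) (g (h j) y) (g (h j) w).
lra.
Qed.

Let cyl_near B c y : (forall k, B k -> exists j, h j = k) -> keys_in B c ->
  cyl g c y -> exists n, near n y `<=` cyl g c.
Proof.
move=> hB; elim: c => [|t c IH] oc cy; first by exists 0%N; rewrite cyl_nil.
have [||n nc] := IH; do ?by move=> u uc; (apply: oc || apply: cy);
  rewrite inE uc orbT.
have [j hj] := hB _ (oc _ (mem_head _ _)).
have /andP[ty yt] := cy _ (mem_head _ _).
pose e := Num.min (g t.1 y - ratr t.2.1) (ratr t.2.2 - g t.1 y).
have e0 : 0 < e by rewrite lt_min !subr_gt0 ty.
have [m me] : exists m, 2^-1 ^+ m < e.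
  exists (Num.bound e^-1); rewrite exprVn invf_plt ?posrE ?exprn_gt0 //.
  apply: lt_trans (archi_boundP _) _; first by rewrite invr_ge0 ltW.
  by rewrite -natrX ltr_nat ltn_expl.
exists (maxn n (maxn m j.+1)) => z yz u; rewrite inE => /orP[/eqP->|]; last first.
  by apply: nc; apply: near_le yz; exact: leq_maxl.
have := near_le (leq_trans (leq_maxl m j.+1) (leq_maxr n _)) yz.
have jm : (j < maxn n (maxn m j.+1))%N by rewrite !leq_max leqnn !orbT.
have := yz j jm; rewrite hj => + _ => yzj.
have : `|g t.1 y - g t.1 z| < e.
  apply: lt_trans me; apply: lt_le_trans yzj _.
  by apply: ler_wiXn2l; rewrite ?invr_le1 ?unitfE ?invr_ge0 ?ler1n //
    !leq_max leqnn orbT.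
rewrite /e lt_min !ltr_norml => /andP[/andP[? ?] /andP[? ?]].
apply/andP; split; lra.
Qed.

(** In a metric space the union of the balls about points of U whose radius is
    half that of a ball with trace in U is an extension of U: if two such balls
    for U and V meet, then the centre of the smaller one lies in the doubled
    larger one. Here near n stands for the balls of radius 2 ^ (-n). *)
Lemma countable_extendable B : (forall j, B (h j)) ->
  (forall k, B k -> exists j, h j = k) -> extendable B.
Proof.
move=> Bh hB.
pose ball_in n x (U : set X) := forall x', near n (i x) (i x') -> U x'.
pose e U : set Y := [set y | exists n x, ball_in n x U /\ near n.+1 (i x) y].
have nearxx n y : near n y y by move=> j _; rewrite subrr normr0 exprn_gt0.
exists e; split.
- move=> U _ y [n [x [xU xy]]]; have [c [oc cy cn]] := near_Bopen Bh xy.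
  by exists c; split=> // z /cn xz; exists n, x.
- move=> U V _ _ UV; apply/seteqP; split=> // y.
  move=> [[n [x [xU xy]]] [m [x' [xV x'y]]]].
  wlog nm : n m x x' U V UV xU xy xV x'y / (n <= m)%N => [th|].
    have [nm|/ltnW mn] := leqP n m; first exact: (th n m x x' U V).
    by apply: (th m n x' x V U); rewrite // setIC.
  have Ux' : U x' by apply: xU; apply: near_tri nm xy x'y.
  have : set0 x' by rewrite -UV; split=> //; exact: xV.
  by [].
- by move=> U _ x' [n [x [xU xx']]]; apply: xU; exact: near_le xx'.
- move=> U c _ oc [x cx] cU; have [n nc] := cyl_near hB oc cx.
  exists x; split=> //; exists n, x; split=> // x' xx'; apply: cU.
  exact: nc xx'.
Qed.

End Countable.

Section Union.
Variables (lt : K -> K -> Prop) (D : set K) (B : K -> set K).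
Hypothesis lt_wf : well_founded lt.
Hypothesis lt_total : forall x y, [\/ lt x y, x = y | lt y x].
Hypothesis D0 : D !=set0.
Hypothesis D_down : forall x y, lt x y -> D y -> D x.
Hypothesis B_mono : forall x y, lt x y -> D y -> B x `<=` B y.
Hypothesis f_continuous : forall k, continuous (f k).
Hypothesis B_skel : forall y, D y -> (exists x, lt x y) ->
  skeletal_on f (\bigcup_(x in [set x | lt x y]) B x).
Variable e : K -> set X -> set Y.
Hypothesis eP : forall x, D x -> extender (B x) (e x).

Let below y := \bigcup_(x in [set x | lt x y]) B x.

(* The interior of the closure of U in the topology of the coordinates in C. *)
Let shadow (C : set K) (U : set X) : set X := [set x | exists c,
  [/\ keys_in C c, cyl f c x & forall d, keys_in C d ->
     cyl f (c ++ d) !=set0 -> cyl f (c ++ d) `&` U !=set0]].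

(** The operators obtained from the e y by recursion along lt, written as an
    inductive predicate on points. [Glue_low] makes glue y at least as large as
    the earlier operators on sets that are open over the earlier B x; this is
    the coherence needed at unions. [Glue_new] uses the given operator e y, cut
    down by the earlier operators at the shadow of U: a set P over an earlier
    B x that is disjoint from U is disjoint from the shadow of U as well, hence
    the cut keeps the new points of U away from the low points of P. *)
Inductive glue (y : K) (U : set X) (p : Y) : Prop :=
| Glue_low x of lt x y & glue x (Bint f (B x) U) p
| Glue_min of (forall x, ~ lt x y) & e y U p
| Glue_new x of lt x y & e y U p &
    glue x (Bint f (B x) (shadow (below y) U)) p.

Let lt_max (E : set K) x x' : E x -> E x' ->
  exists2 z, E z & (x = z \/ lt x z) /\ (x' = z \/ lt x' z).
Proof.
move=> Ex Ex'; have [xx'|->|x'x] := lt_total x x'.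
- by exists x' => //; split; [right|left].
- by exists x' => //; split; left.
- by exists x => //; split; [left|right].
Qed.

Let B_le x z : D z -> x = z \/ lt x z -> B x `<=` B z.
Proof. by move=> Dz [->//|xz]; exact: B_mono xz Dz. Qed.

Let glue_le x z U p : (x = z \/ lt x z) -> D z ->
  glue x (Bint f (B x) U) p -> glue z (Bint f (B z) U) p.
Proof.
move=> [->//|xz] Dz xUp; apply: (Glue_low xz).
by rewrite Bint_Bint //; exact: B_mono.
Qed.

Let disjoint_Bint C U V : U `&` V = set0 -> Bint f C U `&` Bint f C V = set0.
Proof.
move=> UV; apply/seteqP; split=> // x [Ux Vx].
by rewrite -UV; split; [exact: Bint_sub Ux|exact: Bint_sub Vx].
Qed.

(** Density is where skeletality of the union of the earlier B x enters. The
    set e y U meets a given cylinder inside U in an open set, and the shadow of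
    the latter contains a cylinder d over some earlier B x. The earlier
    operator has a point over d, and around that point a whole cylinder over
    B x, which by the choice of d returns to the open set. *)
Let glue_extender y : D y -> extender (B y) (glue y).
Proof.
elim: (lt_wf y) => {}y _ IH Dy.
have {}IH x : lt x y -> extender (B x) (glue x).
  by move=> xy; apply: IH => //; exact: D_down xy Dy.
have [eo edis esub edense] := eP Dy.
have glue_disj x x' P Q p : P `&` Q = set0 -> lt x y -> lt x' y ->
    glue x (Bint f (B x) P) p -> glue x' (Bint f (B x') Q) p -> False.
  move=> PQ xy x'y xp x'p.
  have [z zy [xz x'z]] := lt_max (E := [set u | lt u y]) xy x'y.
  have Dz := D_down zy Dy.
  have [_ zdis _ _] := IH z zy.
  have := zdis _ _ (@Bint_open _ _ _ f _ P) (@Bint_open _ _ _ f _ Q)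
    (disjoint_Bint _ PQ).
  move=> /seteqP[/(_ p) + _]; apply; split.
    exact: glue_le xp.
  exact: glue_le x'p.
have disj_shadow P x Q : lt x y -> P `&` Q = set0 ->
    Bint f (B x) P `&` shadow (below y) Q = set0.
  move=> xy PQ; apply/seteqP; split=> // z [[c [oc cz cP]] [d [od dz dQ]]].
  have oc' : keys_in (below y) c by move=> t /oc Bt; exists x.
  have [|w] := dQ c oc'; first by exists z; rewrite cyl_cat.
  rewrite cyl_cat => -[[_ /cP Pw] Qw].
  by have : set0 w by rewrite -PQ.
split.
- move=> U oU p [x xy xp|ymin ep|x xy ep xp].
  + have [xo _ _ _] := IH x xy.
    have [c [oc cp cs]] := xo _ (@Bint_open _ _ _ f _ U) p xp.
    exists c; split=> //; first exact: keys_in_sub (B_mono xy Dy) oc.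
    by move=> q /cs; exact: Glue_low xy.
  + have [c [oc cp cs]] := eo U oU p ep.
    by exists c; split=> // q /cs; exact: Glue_min.
  + have [xo _ _ _] := IH x xy.
    have [c [oc cp cs]] := xo _ (@Bint_open _ _ _ f _ _) p xp.
    have [d [od dp ds]] := eo U oU p ep.
    exists (c ++ d); rewrite cyl_cat; split=> //.
      by apply: keys_in_cat => //; exact: keys_in_sub (B_mono xy Dy) oc.
    by move=> q [/cs xq /ds eq]; exact: Glue_new xy eq xq.
- move=> U V oU oV UV; apply/seteqP; split=> // p [Up Vp].
  have VU : V `&` U = set0 by rewrite setIC.
  have low_new (P Q : set X) x x' : P `&` Q = set0 -> lt x y -> lt x' y ->
      glue x (Bint f (B x) P) p ->
      glue x' (Bint f (B x') (shadow (below y) Q)) p -> False.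
    move=> PQ xy x'y; rewrite -(Bint_Bint f P (B' := B x) (B := B x)) //.
    by apply: glue_disj => //; exact: disj_shadow.
  have e_disj : e y U p -> e y V p -> False.
    by move=> eU eV; have /seteqP[/(_ p) + _] := edis _ _ oU oV UV; apply.
  case: Up Vp => [x xy xp|ymin ep|x xy ep xp];
    case=> [x' x'y x'p|ymin' ep'|x' x'y ep' x'p];
    do ?[by case: (ymin' _ xy)|by case: (ymin _ x'y)|exact: e_disj].
  + exact: glue_disj xp x'p.
  + exact: low_new xp x'p.
  + exact: low_new x'p xp.
- move=> U oU z [x xy xp|ymin ep|x xy ep xp].
  + have [_ _ xsub _] := IH x xy.
    exact: Bint_sub (xsub _ (@Bint_open _ _ _ f _ U) z xp).
  + exact: esub ep.
  + exact: esub ep.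
- move=> U c oU oc c0 cU.
  have [w [cw ew]] := edense U c oU oc c0 cU.
  have [[x0 x0y]|ymin] := pselect (exists x, lt x y); last first.
    by exists w; split=> //; apply: Glue_min => // x xy; apply: ymin; exists x.
  have [W1o W10] : nonempty_open (cyl f c `&` i @^-1` e y U).
    split; last by exists w.
    apply: openI; first exact: cyl_open.
    exact: (Bopen_open f_continuous (Bopen_preimage (eo U oU))).
  have [d [od [z dz] dW]] := B_skel Dy (ex_intro _ x0 x0y) (conj W1o W10).
  have [x xy xd] : exists2 x, lt x y & keys_in (B x) d.
    apply: keys_in_bigcup od; first by exists x0.
    move=> x x' xy x'y.
    have [t ty [xt x't]] := lt_max (E := [set u | lt u y]) xy x'y.
    by exists t => //; split; exact: B_le (D_down ty Dy) _.
  have [xo _ _ xdense] := IH x xy.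
  set S := Bint f (B x) (shadow (below y) U).
  have dS : cyl f d `<=` S.
    move=> v dv; exists d; split=> // v' dv'; exists d; split=> // d' od' dd'.
    have [v'' [dv'' [cv'' ev'']]] := dW d' od' dd'.
    by exists v''; split=> //; exact: cU.
  have [|v [dv xv]] := xdense S d (@Bint_open _ _ _ f _ _) xd _ dS.
    by exists z.
  have [d' [xd' d'v d'x]] := xo S (@Bint_open _ _ _ f _ _) _ xv.
  have [||u [du [cu eu]]] := dW d'.
  - by move=> t /xd' Bt; exists x.
  - by exists v; rewrite cyl_cat.
  exists u; split=> //; apply: (Glue_new xy eu); apply: d'x.
  by move: du; rewrite cyl_cat => -[].
Qed.

(** The operator on the union: a set open over the union is exhausted by its
    parts open over the B x, and the glued operators agree there. *)
Lemma union_extendable : extendable (\bigcup_(x in D) B x).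
Proof.
have dirB x y : D x -> D y -> exists2 z, D z & B x `<=` B z /\ B y `<=` B z.
  move=> Dx Dy; have [z Dz [xz yz]] := lt_max Dx Dy.
  by exists z => //; split; exact: B_le Dz _.
exists (fun U p => exists2 x, D x & glue x (Bint f (B x) U) p); split.
- move=> U oU p [x Dx xp]; have [xo _ _ _] := glue_extender Dx.
  have [c [oc cp cs]] := xo _ (@Bint_open _ _ _ f _ U) p xp.
  exists c; split=> //; last by move=> q /cs xq; exists x.
  by move=> t /oc Bt; exists x.
- move=> U V _ _ UV; apply/seteqP; split=> // p [[x Dx xp] [y Dy yp]].
  have [z Dz [xz yz]] := lt_max Dx Dy.
  have [_ zdis _ _] := glue_extender Dz.
  have := zdis _ _ (@Bint_open _ _ _ f _ U) (@Bint_open _ _ _ f _ V)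
    (disjoint_Bint _ UV).
  by move=> /seteqP[/(_ p) + _]; apply; split; [exact: glue_le xp|exact: glue_le yp].
- move=> U oU w [x Dx xw]; have [_ _ xsub _] := glue_extender Dx.
  exact: Bint_sub (xsub _ (@Bint_open _ _ _ f _ U) w xw).
- move=> U c oU oc c0 cU; have [x Dx xc] := keys_in_bigcup D0 dirB oc.
  have [_ _ _ xdense] := glue_extender Dx.
  have [|w [cw xw]] := xdense _ c (@Bint_open _ _ _ f _ U) xc c0.
    by move=> w cw; exists c.
  by exists w; split=> //; exists x.
Qed.

End Union.
End Extenders.

(** * Extension operators from skeletal sets of coordinates *)

Section PiRegular.
Context {R : realType} {K : choiceType} (X Y : topologicalType).
Variables (i : X -> Y) (g : K -> Y -> R).
Let f k := g k \o i.
Hypothesis g_continuous : forall k, continuous (g k).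
Hypothesis f_generating : generating f.
Variable phi : seq (boxcode K) -> boxcode K.
Hypothesis phi_skeletal : forall B, closed_under phi B -> skeletal_on f B.

(** The hull of C and D is the union of the sets B x, the hulls of C, x and the
    predecessors of x, for x in D. The hypothesis applies to them with x moved
    into the countable part C'. *)
Let extendable_hull_step (lt : K -> K -> Prop) (D C : set K) :
  well_founded lt -> (forall x y z, lt x y -> lt y z -> lt x z) ->
  (forall x y, [\/ lt x y, x = y | lt y x]) ->
  D !=set0 -> (forall x y, lt x y -> D y -> D x) -> countable C ->
  (forall x C', D x -> countable C' -> C' !=set0 ->
     extendable i g (hull phi (C' `|` [set z | lt z x]))) ->
  extendable i g (hull phi (C `|` D)).
Proof.
move=> wf tr tot [x0 Dx0] down cC IH.
pose B x := hull phi ((C `|` [set x]) `|` [set z | lt z x]).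
have Bmono x y : lt x y -> B x `<=` B y.
  move=> xy; apply: hull_sub => z [[Cz|->]|zx]; first by left; left.
    by right.
  by right; exact: tr zx xy.
have Bdir x y : exists2 z, z = x \/ z = y & B x `<=` B z /\ B y `<=` B z.
  have [xy|->|yx] := tot x y.
  - by exists y; [right|split=> //; exact: Bmono].
  - by exists y; [right|split].
  - by exists x; [left|split=> //; exact: Bmono].
have Bclosed (E : set K) : E !=set0 -> closed_under phi (\bigcup_(x in E) B x).
  move=> E0; apply: closed_under_bigcup => // [x y Ex Ey|x _]; last first.
    exact: hull_closed.
  by have [z zxy zB] := Bdir x y; exists z => //; case: zxy => ->.
have -> : hull phi (C `|` D) = \bigcup_(x in D) B x.
  apply/seteqP; split.
    apply: hull_min; first by apply: Bclosed; exists x0.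
    move=> z [Cz|Dz].
      by exists x0 => //; apply: sub_hull; left; left.
    by exists z => //; apply: sub_hull; left; right.
  move=> z [x Dx]; apply: hull_sub => w [[Cw|->]|wx]; first by left.
    by right.
  by right; exact: down wx Dx.
have /choice[e eP] : forall x, exists e, D x -> extender i g (B x) e.
  move=> x; have [Dx|nDx] := pselect (D x); last by exists (fun _ => set0).
  have [||e eP] := IH x (C `|` [set x]) Dx; last by exists e.
    by apply: countable_setU => //; exact: countable1.
  by exists x; right.
have cf k : continuous (f k) by have [] := f_generating.
apply: (union_extendable wf tot _ down _ cf _ eP); first by exists x0.
- by move=> x y xy _; exact: Bmono.
- by move=> y _ y0; apply: phi_skeletal; exact: Bclosed.
Qed.

(** Well-founded induction over initial segments of K, with the countable set C
    generalized; for the empty segment the hull of C is countable. *)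
Lemma extendable_setT (k0 : K) : extendable i g setT.
Proof.
have [lt [wf tr tot]] := strict_well_order K.
have seg y C : countable C -> C !=set0 ->
    extendable i g (hull phi (C `|` [set z | lt z y])).
  elim: (wf y) C => {}y _ IH C cC C0.
  have [y0|/set0P y0] := eqVneq [set z | lt z y] set0.
    rewrite y0 setU0; have [c Cc] := C0.
    have [|h [Bh hB]] := countable_enum (countable_hull phi cC).
      by exists c; exact: sub_hull.
    exact: countable_extendable Bh hB.
  apply: (extendable_hull_step wf) => //; first by move=> x z; exact: tr.
  by move=> x C' xy cC' C'0; exact: IH.
have -> : setT = hull phi ([set k0] `|` setT) :> set K.
  by apply/seteqP; split=> // k _; apply: sub_hull; right.
apply: (extendable_hull_step wf) => //; first by exists k0.
by move=> x C' _; exact: seg.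
Qed.

Lemma skeletal_pi_regular (k0 : K) : pi_regular i.
Proof.
have [e [eo edis esub edense]] := extendable_setT k0.
have [cf gf] := f_generating.
exists e; split.
- move=> U oU; apply: (Bopen_open (f := g) (B := setT)) => //.
  exact: eo (gf _ oU).
- by move=> U V oU oV; apply: edis; exact: gf.
- move=> U oU; split; first exact: esub (gf _ oU).
  move=> x Ux W; rewrite nbhsE; case=> O [oO Ox] OW.
  have [c [oc cx cOU]] := gf _ (openI oO oU) x (conj Ox Ux).
  have [||w [cw ew]] := edense U c (gf _ oU) oc; first by exists x.
    by move=> w /cOU[].
  by exists w; split=> //; apply: OW; have [] := cOU _ cw.
Qed.

End PiRegular.

(** * Skeletal sets of coordinates from the cube *)

Section Cube.
Context {R : realType} {K : choiceType} (X : topologicalType).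
Variable f : K -> X -> R.
Let cube : topologicalType := prod_topology (fun _ : K => R).
Let diag (x : X) : cube := fun k => f k x.
Let g (k : K) (z : cube) := z k.

(** Suppose that W violates skeletality of B and let x0 be a point of X in e W,
    with a cylinder c0 around it inside e W. The part c of c0 over B shrinks to
    a cylinder c ++ d over B that misses W, so that e W and e (cyl f (c ++ d))
    are disjoint. But phi provides a point y of the latter, depending only on
    B; the point z with the B-coordinates of y and the other coordinates of x0
    lies in both. *)
Lemma pi_regular_skeletal_on : generating f -> pi_regular diag ->
  exists phi, forall B, closed_under phi B -> skeletal_on f B.
Proof.
move=> [cf gf] [e [eo edis edense]].
have [_ gg] := @cube_generating R K.
have cyl_o c : open (cyl f c) by exact: cyl_open.
have /choice[phi phiP] : forall c, exists d, cyl f c !=set0 ->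
    cyl g d !=set0 /\ cyl g d `<=` cyl g c `&` e (cyl f c).
  move=> c; have [[x cx]|] := pselect (cyl f c !=set0); last by exists [::].
  have [_ /(_ x cx)] := edense _ (cyl_o c).
  move=> /(_ (cyl f c)) [|y [ey cy]].
    exact: open_nbhs_nbhs.
  have oW : open (cyl g c `&` e (cyl f c)).
    apply: openI; last exact: eo.
    by apply: cyl_open => k; exact: (@prod_coord_continuous _ (fun _ : K => R)).
  have [d [_ dy dW]] := gg _ oW (diag y) (conj cy ey).
  by exists d => _; split=> //; exists (diag y).
exists (fun s => phi (head [::] s)) => B cB.
apply: contrapT => /not_skeletal_on[W [oW W0] avoid].
have [w Ww] := W0.
have [eWW /(_ w Ww W)[|x0 [eWx0 _]]] := edense W oW.
  exact: open_nbhs_nbhs.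
have [c0 [_ c0x0 c0W]] := gg _ (eo _ oW) _ eWx0.
pose c := [seq t <- c0 | `[< B t.1 >]].
have oc : keys_in B c by move=> t; rewrite mem_filter => /andP[/asboolP].
have cx0 : cyl f c x0.
  by move=> t; rewrite mem_filter => /andP[_ tc0]; exact: c0x0.
have [d [od cd0 cdW]] := avoid c oc (ex_intro _ _ cx0).
have ocd := keys_in_cat oc od.
have [[y dy] dsub] := phiP _ cd0.
have od' : keys_in B (phi (c ++ d)).
  by apply: (cB [:: c ++ d]) => u; rewrite inE => /eqP->.
pose z : cube := fun k => if `[< B k >] then y k else f k x0.
have zy k : B k -> z k = y k by move=> Bk; rewrite /z asboolT.
have [_ ez] : (cyl g (c ++ d) `&` e (cyl f (c ++ d))) z.
  by apply: dsub => t td; rewrite /g zy; [exact: dy|exact: od'].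
have eWz : e W z.
  apply: c0W => t tc0; rewrite /g /z; case: asboolP => [Bt|_]; last exact: c0x0.
  have [cdy _] := dsub _ dy; apply: cdy; rewrite mem_cat mem_filter tc0 andbT.
  by rewrite asboolT.
have : set0 z by rewrite -(edis _ _ (cyl_o (c ++ d)) oW cdW).
by [].
Qed.

End Cube.

(** * The inverse system of countable closed sets of coordinates *)

Section CoordinateSpace.
Context {R : realType} {K : choiceType} (X : topologicalType).
Variables (f : K -> X -> R) (B : set K).

Let cube : topologicalType := prod_topology (fun _ : K => R).
Let g (k : K) (z : cube) : R := z k.

(** The coordinates outside B are set to 0, so that the images for different
    B are subspaces of the same cube. *)
Definition coord (x : X) : prod_topology (fun _ : K => R) :=
  fun k => if `[< B k >] then f k x else 0.

Definition coord_space := set_type (range coord).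
HB.instance Definition _ := Topological.on coord_space.

Definition to_coord (x : X) : coord_space :=
  SigSub (mem_set (imageT coord x)).

Definition coord_cyl (c : boxcode K) : set coord_space :=
  [set y | cyl g c (val y)].

Lemma to_coord_surj (y : coord_space) : exists x, to_coord x = y.
Proof.
case: y => z zB; have [x _ xz] := set_mem zB.
by exists x; apply: val_inj.
Qed.

Lemma to_coord_eq x x' :
  to_coord x = to_coord x' <-> forall k, B k -> f k x = f k x'.
Proof.
split=> [/(congr1 val) /= xx' k Bk|xx'].
  by have := congr1 (@^~ k) xx'; rewrite /coord asboolT.
by apply: val_inj; apply/funext => k /=; rewrite /coord; case: asboolP => // /xx'.
Qed.

Lemma coord_cylE c x : keys_in B c -> coord_cyl c (to_coord x) <-> cyl f c x.
Proof.
move=> oc; split=> cx t tc; have := cx t tc; rewrite /g /= /coord asboolT //;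
  exact: oc.
Qed.

Let g_continuous k : continuous (g k).
Proof. exact: (@prod_coord_continuous _ (fun _ : K => R)). Qed.

Lemma coord_cyl_open c : open (coord_cyl c).
Proof. by exists (cyl g c); [exact: cyl_open|rewrite set_valE]. Qed.

(** The topology of the image is that of the quotient of X with the initial
    topology of the coordinates in B; topological statements about the images
    are thereby pulled back to X. *)
Lemma open_coordP (U : set coord_space) :
  open U <-> Bopen f B (to_coord @^-1` U).
Proof.
split=> [[V oV]|oU].
  rewrite set_valE => <- x Vx.
  have [_ gg] := @cube_generating R K.
  have [c [_ cx cV]] := gg _ oV _ Vx.
  pose c' := [seq t <- c | `[< B t.1 >]].
  exists c'; split.
  - by move=> t; rewrite mem_filter => /andP[/asboolP].
  - move=> t; rewrite mem_filter => /andP[/asboolP Bt tc].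
    by have := cx t tc; rewrite /g /= /coord asboolT.
  - move=> x' cx'; apply: cV => t tc; have := cx t tc.
    rewrite /g /= /coord; case: asboolP => // Bt _; apply: cx'.
    by rewrite mem_filter tc asboolT.
rewrite openE => y; have [x <-] := to_coord_surj y => /oU[c [oc cx cU]].
rewrite /interior nbhsE; exists (coord_cyl c).
  by split; [exact: coord_cyl_open|apply/coord_cylE].
move=> y'; have [x' <-] := to_coord_surj y'.
by move=> /(coord_cylE _ oc) /cU.
Qed.

Lemma coord_space_tychonoff : [set: X] !=set0 -> tychonoff_space coord_space.
Proof.
move=> [x0 _]; split; first by exists (to_coord x0).
  rewrite open_hausdorff => y y' yy'.
  have : val y != val y' by apply: contra yy' => /eqP/val_inj ->.
  have := @cube_hausdorff R K; rewrite open_hausdorff => /[apply].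
  move=> [[U V] /= [Uy Vy'] [oU oV UV]].
  exists (val @^-1` U, val @^-1` V) => /=.
    by split; apply/mem_set; exact: set_mem.
  split; [by exists U => //; rewrite set_valE|by exists V => //; rewrite set_valE|].
  by rewrite -preimage_setI (eqP UV) preimage_set0.
exact: (@uniform_completely_regular R (set_type (range coord))).
Qed.

Lemma coord_space_second_countable : countable B -> @second_countable coord_space.
Proof.
move=> cB; exists (coord_cyl @` [set c | keys_in B c]).
  apply: (sub_countable (card_image_le _ _)).
  apply: (@sub_countable _ _ _ (head [::] @` all_keys_in B)); last first.
    by apply: (sub_countable (card_image_le _ _)); exact: countable_all_keys_in.
  apply: subset_card_le => c oc; exists [:: c] => //.
  by move=> d; rewrite inE => /eqP->.
split=> [_ [c _ <-]|y U]; first exact: coord_cyl_open.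
rewrite nbhsE => -[V [oV Vy] VU].
have [x xy] := to_coord_surj y; subst y.
have /open_coordP/(_ x Vy)[c [oc cx cV]] := oV.
exists (coord_cyl c); first by split; [exists c|apply/coord_cylE].
move=> y; have [x' <-] := to_coord_surj y => /(coord_cylE _ oc) /cV.
exact: VU.
Qed.

End CoordinateSpace.

Section Bonds.
Context {R : realType} {K : choiceType} (X : topologicalType).
Variable f : K -> X -> R.

(** For B contained in B' the choice of a preimage in X does not matter, as
    the B'-coordinates of a point determine its B-coordinates. *)
Definition coord_bond (B B' : set K) (y : coord_space f B') : coord_space f B :=
  to_coord f B (projT1 (cid (to_coord_surj y))).

Lemma coord_bondE (B B' : set K) x : B `<=` B' ->
  @coord_bond B B' (to_coord f B' x) = to_coord f B x.
Proof.
move=> BB'; rewrite /coord_bond; case: cid => x' /= /to_coord_eq xx'.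
by apply/to_coord_eq => k /BB'; exact: xx'.
Qed.

Lemma coord_bond_continuous (B B' : set K) : B `<=` B' ->
  continuous (@coord_bond B B').
Proof.
move=> BB'; apply/continuousP => U /open_coordP oU; apply/open_coordP.
have -> : to_coord f B' @^-1` (@coord_bond B B' @^-1` U) = to_coord f B @^-1` U.
  by apply/seteqP; split=> x /=; rewrite coord_bondE.
exact: Bopen_sub oU.
Qed.

End Bonds.

Section System.
Context {R : realType} {K : choiceType} (X : topologicalType).
Variable f : K -> X -> R.
Hypothesis X0 : [set: X] !=set0.
Hypothesis X_hausdorff : hausdorff_space X.
Hypothesis f_gen : generating f.
Variable phi : seq (boxcode K) -> boxcode K.
Hypothesis phi_skeletal : forall B, countable B -> closed_under phi B ->
  skeletal_on f B.

Definition admissible : pred (set K) :=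
  fun B => `[< countable B /\ closed_under phi B >].
Definition coord_index := {B : set K | admissible B}.
HB.instance Definition _ := SubChoice.on coord_index.
HB.instance Definition _ :=
  [SubChoice_isSubPOrder of coord_index by <: with set_display].

Let leP (a b : coord_index) : (a <= b)%O <-> val a `<=` val b.
Proof. by rewrite leEsub subsetEset. Qed.

Let index_countable (a : coord_index) : countable (val a).
Proof. by have /asboolP[] := valP a. Qed.

Let index_closed (a : coord_index) : closed_under phi (val a).
Proof. by have /asboolP[] := valP a. Qed.

Let index_hull (C : set K) : countable C -> exists a : coord_index, C `<=` val a.
Proof.
move=> cC; have aC : admissible (hull phi C).
  by apply/asboolP; split; [exact: countable_hull|exact: hull_closed].
by exists (exist (fun B => admissible B) _ aC); exact: sub_hull.
Qed.

Let index_bigcup (C : set coord_index) : C !=set0 -> countable C ->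
  (forall a b, C a -> C b -> exists2 c, C c & (a <= c)%O /\ (b <= c)%O) ->
  exists a : coord_index, val a = \bigcup_(b in C) val b.
Proof.
move=> C0 cC dirC; have aC : admissible (\bigcup_(b in C) val b).
  apply/asboolP; split; first by apply: bigcup_countable.
  apply: closed_under_bigcup => // a b Ca Cb.
  have [c Cc [/leP ac /leP bc]] := dirC a b Ca Cb; by exists c.
by exists (exist (fun B => admissible B) _ aC).
Qed.

Let bond (a b : coord_index) (ab : (a <= b)%O) :
    coord_space f (val b) -> coord_space f (val a) :=
  @coord_bond R K X f (val a) (val b).

Let bondE (a b : coord_index) (ab : (a <= b)%O) x :
  bond ab (to_coord f (val b) x) = to_coord f (val a) x.
Proof. by apply: coord_bondE; apply/leP. Qed.

Definition coord_system : inverse_system coord_index.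
Proof.
apply: (@InverseSystem _ _ (fun a : coord_index => coord_space f (val a)) bond).
- by move=> a aa y; have [x <-] := to_coord_surj y; rewrite bondE.
- by move=> a b c ab bc ac y; have [x <-] := to_coord_surj y; rewrite !bondE.
- by move=> a b ab; apply: coord_bond_continuous; apply/leP.
Defined.

Let S := coord_system.

Let SE (a b : coord_index) (ab : (a <= b)%O) x :
  Defs.bond S ab (to_coord f (val b) x) = to_coord f (val a) x.
Proof. exact: bondE. Qed.

Let directed_index : directed coord_index.
Proof.
split; first by have [a _] := index_hull (countable0 K); exists a.
move=> a b; have [c abc] :=
  index_hull (countable_setU (index_countable a) (index_countable b)).
by exists c; split; apply/leP => k kab; apply: abc; [left|right].
Qed.

Let sigma_complete_index : sigma_complete coord_index.
Proof.
move=> C C0 cC tC.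
have [a b Ca Cb|a aE] := index_bigcup C0 cC.
  by have [ab|ba] := tC a b Ca Cb; [exists b|exists a].
exists a; split=> [b Cb|b Cb]; apply/leP; rewrite aE.
  by move=> k bk; exists b.
by move=> k [c /Cb /leP cb /cb].
Qed.

Let S_spaces a : tychonoff_space (S a) /\ @second_countable (S a).
Proof.
split; first exact: coord_space_tychonoff.
exact: coord_space_second_countable.
Qed.

Let S_skeletal (a b : coord_index) (ab : (a <= b)%O) :
  skeletal (Defs.bond S ab) /\ range (Defs.bond S ab) = setT.
Proof.
split; last first.
  apply/seteqP; split=> // y _; have [x <-] := to_coord_surj y.
  by exists (to_coord f (val b) x) => //; rewrite SE.
move=> U [/open_coordP oU [y Uy]].
have [x xy] := to_coord_surj y; subst y.
have [cf _] := f_gen.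
have [|c [oc [z cz] dense_c]] := phi_skeletal (index_countable a) (@index_closed a)
    (U := to_coord f (val b) @^-1` U).
  by split; [exact: Bopen_open oU|exists x].
exists (to_coord f (val a) z).
rewrite /interior nbhsE; exists (coord_cyl c).
  by split; [exact: coord_cyl_open|apply/coord_cylE].
move=> y'; have [z' <-] := to_coord_surj y' => /(coord_cylE _ _ oc) cz' W.
rewrite nbhsE => -[V [/open_coordP oV Vz'] VW].
have [d [od dz' dV]] := oV z' Vz'.
have [|u [+ Uu]] := dense_c d od; first by exists z'; rewrite cyl_cat.
rewrite cyl_cat => -[_ /dV Vu].
exists (to_coord f (val a) u); split; last exact: VW.
by exists (to_coord f (val b) u) => //; rewrite SE.
Qed.

(** The supremum of a chain is its union, whose codes live on a member of the
    chain; this gives the embedding. The range is dense because a point w of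
    the sequential limit agrees up to any stage n with the image of a point of
    X, namely of a preimage of w n. *)
Let S_continuous (alpha : nat -> coord_index)
    (alphaS : forall n, (alpha n <= alpha n.+1)%O)
    (beta : coord_index) (alpha_beta : forall n, (alpha n <= beta)%O) :
  supremums (range alpha) beta ->
  let q : S beta -> prod_topology (fun n => S (alpha n)) :=
    fun x n => Defs.bond S (alpha_beta n) x in
  embedding q /\ dense_subset (range q) (sequential_limit S alphaS).
Proof.
move=> [_ beta_least] q.
have qE x n : q (to_coord f (val beta) x) n = to_coord f (val (alpha n)) x.
  exact: SE.
have alpha_mono m n : (m <= n)%N -> (alpha m <= alpha n)%O.
  move=> /subnK<-; elim: (n - m)%N => [|p IH] //.
  by rewrite addSn (le_trans IH).
have alpha_dir a b : range alpha a -> range alpha b ->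
    exists2 c, range alpha c & (a <= c)%O /\ (b <= c)%O.
  move=> [m _ <-] [n _ <-]; exists (alpha (maxn m n)) => //.
  by split; apply: alpha_mono; rewrite ?leq_maxl ?leq_maxr.
have beta_cup : val beta `<=` \bigcup_n val (alpha n).
  have [||gam gamE] := index_bigcup _ _ alpha_dir.
  - by exists (alpha 0%N); exists 0%N.
  - by apply: (sub_countable (card_image_le _ _)); exact: countableP.
  have /leP : (beta <= gam)%O.
    apply: beta_least => a [n _ <-]; apply/leP; rewrite gamE => k ak.
    by exists (alpha n).
  rewrite gamE => bg k /bg[_ [n _ <-] ak]; by exists n.
split; last split.
- apply: local_embedding.
  + move=> y y'; have [x <-] := to_coord_surj y; have [x' <-] := to_coord_surj y'.
    move=> qq; apply/to_coord_eq => k /beta_cup[n _ ak].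
    have := congr1 (@^~ n) qq; rewrite !qE => /to_coord_eq; exact.
  + by apply: prod_continuous => n; exact: bond_continuous.
  + move=> U y /open_coordP oU; have [x <-] := to_coord_surj y => Ux.
    have [c [oc cx cU]] := oU x Ux.
    have [|m n _ _|n _ ocn] := keys_in_bigcup (D := setT) (B := fun n => val (alpha n))
      _ _ (keys_in_sub beta_cup oc).
    * by exists 0%N.
    * exists (maxn m n) => //; split; apply/leP; apply: alpha_mono;
        by rewrite ?leq_maxl ?leq_maxr.
    exists ((fun w : prod_topology (fun n => S (alpha n)) => w n) @^-1` coord_cyl c).
    split.
    * apply: open_comp; last exact: coord_cyl_open.
      by move=> w _; exact: (@prod_coord_continuous _ (fun n => S (alpha n))).
    * by rewrite /= qE; apply/coord_cylE.
    * move=> y'; have [x' <-] := to_coord_surj y'.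
      by rewrite /= qE => /(coord_cylE _ _ ocn) /cU.
- move=> _ [y _ <-] n; have [x <-] := to_coord_surj y.
  by rewrite !qE SE.
- move=> w wlim W /prod_topology_box[s [sP sW]].
  have w_back m n (mn : (m <= n)%N) x : w n = to_coord f _ x -> w m = to_coord f _ x.
    elim: n mn => [|n IH]; first by rewrite leqn0 => /eqP->.
    rewrite leq_eqVlt => /orP[/eqP->//|mn] wn; apply: IH => //.
    by rewrite -(wlim n) wn SE.
  have [||M /sP[n [V [oV Vw ->]]]|n _ ns] := @directed_finite _ _ [set: nat]
    (fun n => [set M | forall x, w n = to_coord f _ x -> M (q (to_coord f _ x))]) _ _ s.
  + by exists 0%N.
  + move=> m n _ _; exists (maxn m n) => //; split=> M MP x wx; apply: MP;
      by apply: w_back wx; rewrite ?leq_maxl ?leq_maxr.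
  + by exists n => // x wx /=; rewrite qE -wx.
  have [x xw] := to_coord_surj (w n).
  exists (q (to_coord f _ x)); split; first by exists (to_coord f _ x).
  by apply: sW => M Ms; exact: ns.
Qed.

Lemma skeletal_skeletally_generated : skeletally_generated X.
Proof.
have [cf gf] := f_gen.
exists set_display, coord_index, S; split=> //.
pose i x : prod_topology (fun a => S a) := fun a => to_coord f (val a) x.
exists i; split.
- apply: local_embedding.
  + move=> x x' ixx'; apply: (generating_injective X_hausdorff f_gen) => k.
    have [|a ka] := index_hull (C := [set k]); first exact: countable1.
    have /to_coord_eq := congr1 (fun w : prod_topology (fun a => S a) => w a) ixx'.
    by apply; exact: ka.
  + apply: prod_continuous => a; apply/continuousP => U /open_coordP.
    exact: Bopen_open.
  + move=> U x oU Ux; have [c [_ cx cU]] := gf U oU x Ux.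
    have [|a ca] := index_hull (C := [set k | k \in map fst c]).
      by apply: finite_set_countable; exact: finite_seq.
    have oc : keys_in (val a) c by move=> t tc; apply: ca; apply/mapP; exists t.
    exists ((fun w : prod_topology (fun a => S a) => w a) @^-1` coord_cyl c).
    split.
    * apply: open_comp; last exact: coord_cyl_open.
      by move=> w _; exact: (@prod_coord_continuous _ (fun a => S a)).
    * by apply/coord_cylE.
    * by move=> x' /(coord_cylE _ _ oc) /cU.
- by move=> _ [x _ <-] a b ab; exact: SE.
- move=> a; apply/seteqP; split=> // y _; have [x <-] := to_coord_surj y.
  by exists x.
Qed.

End System.

(** * Families of continuous functions *)

Section Families.
Variable R : realType.

Lemma generating_embedding (K : choiceType) (X Y : topologicalType)
    (i : X -> Y) (g : K -> Y -> R) :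
  embedding i -> generating g -> generating (fun k => g k \o i).
Proof.
move=> [inj_i ci open_i] [cg gg]; split=> [k|U oU x Ux].
  by move=> x; apply: continuous_comp; [exact: ci|exact: cg].
have [V oV iU] := open_i U oU.
have Vx : V (i x).
  have : (i @` U) (i x) by exists x.
  by rewrite iU => -[].
have [c [oc cx cV]] := gg V oV _ Vx.
exists c; split=> // x' /cV Vx'.
have [x'' Ux'' /inj_i <- //] : (i @` U) (i x').
by rewrite iU; split=> //; exists x'.
Qed.

(** Every function is an index; the discontinuous ones stand for 0. *)
Definition continuous_family (X : topologicalType) (k : {classic (X -> R)}) :
  X -> R := if `[< continuous (k : X -> R) >] then k else fun _ => 0.

Lemma continuous_family_generating (X : topologicalType) :
  completely_regular_space X -> generating (@continuous_family X).
Proof.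
move=> crX; split=> [k|U oU x Ux].
  rewrite /continuous_family; case: asboolP => // _ x; exact: cvg_cst.
have [f [cf _ f0 f1]] := (@uniform_separatorP X R [set x] (~` U)).1
  (crX x (~` U) (open_closedC oU) (fun nUx => nUx Ux)).
have fE : continuous_family (f : {classic (X -> R)}) = f.
  by rewrite /continuous_family asboolT.
exists [:: (f : {classic (X -> R)}, (-1, 1))]; split=> //.
  move=> t; rewrite inE => /eqP-> /=; rewrite fE.
  have -> : f x = 0 by apply: f0; exists x.
  by rewrite rmorphN1 rmorph1 ltrN10 ltr01.
move=> z /(_ _ (mem_head _ _)) /=; rewrite fE rmorph1 => /andP[_ fz].
apply: contrapT => nUz; have fz1 : f z = 1 by apply: f1; exists z.
by rewrite fz1 ltxx in fz.
Qed.

Lemma diagonal_embedding (K : choiceType) (X : topologicalType) (f : K -> X -> R) :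
  hausdorff_space X -> generating f ->
  embedding (fun x => (fun k => f k x) : prod_topology (fun _ : K => R)).
Proof.
move=> X_hausdorff fgen; have [cf gf] := fgen; apply: local_embedding.
- move=> x x' xx'; apply: (generating_injective X_hausdorff fgen) => k.
  by have := congr1 (@^~ k) xx'.
- by apply: prod_continuous => k; exact: cf.
- move=> U x oU Ux; have [c [_ cx cU]] := gf U oU x Ux.
  exists (cyl (fun k (z : prod_topology (fun _ : K => R)) => z k) c); split=> //.
  by apply: cyl_open; have [] := @cube_generating R K.
Qed.

End Families.

Theorem theorem1p1 (X : topologicalType) (tychX : tychonoff_space X) :
  (I_favorable X <->
     forall (Y : topologicalType) (i : X -> Y),
       tychonoff_space Y -> embedding i -> pi_regular i) /\
  (I_favorable X <-> skeletally_generated X).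
Proof.
pose R : realType := Rdefinitions.R.
have [X0 X_hausdorff X_regular] := tychX.
have favorable_embeddings : I_favorable X ->
    forall (Y : topologicalType) (i : X -> Y),
      tychonoff_space Y -> embedding i -> pi_regular i.
  move=> favX Y i [_ _ Y_regular] emb_i.
  have gg := @continuous_family_generating R Y Y_regular.
  have fg := generating_embedding emb_i gg.
  have [phi phiP] := I_favorable_skeletal_on fg favX.
  apply: (skeletal_pi_regular _ fg phiP) => //.
    by have [] := gg.
  exact: (fun _ => 0).
have embeddings_generated : (forall (Y : topologicalType) (i : X -> Y),
    tychonoff_space Y -> embedding i -> pi_regular i) -> skeletally_generated X.
  move=> piX; have fg := @continuous_family_generating R X X_regular.
  have [phi phiP] := pi_regular_skeletal_on fg
    (piX _ _ (cube_tychonoff _ _) (diagonal_embedding X_hausdorff fg)).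
  by apply: (skeletal_skeletally_generated X0 X_hausdorff fg) => B _; exact: phiP.
have generated_favorable : skeletally_generated X -> I_favorable X.
  move=> [d [A [S [[dirA sigA] spaceS skelS contS [i [emb_i lim_i onto_i]]]]]].
  apply: (inverse_system_I_favorable dirA sigA spaceS skelS _ emb_i lim_i onto_i).
  by move=> alpha alphaS beta alpha_beta /(contS _ alphaS _ alpha_beta)[].
by split; split=> [favX|H]; auto.
Qed.
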